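(* Let $X$ be any Banach space with a $1$-symmetric basis (this includes all the spaces $\ell_p$ with $1<p<\infty$). Then there exists a countable dense set $S\subseteq X$ that is Rado.
   Context: All normed spaces are real. A (Schauder) basis $(e_i)_{i\in\mathbb{N}}$ of a Banach space is $1$-symmetric if, for any permutation $\pi$ of $\mathbb{N}$ and any sequence $(a_i)$ of real numbers such that $\sum_i a_ie_i$ converges, the sum $\sum_i a_{\pi(i)}e_i$ also converges and $\|\sum_i a_ie_i\|=\|\sum_i a_{\pi(i)}e_i\|$. Let $S$ be a countable dense set in a normed space $X$, and let $p$ be a fixed probability with $0<p<1$. The random graph $G(S,p)$ has vertex set $S$; each pair of distinct points $x,y\in S$ with $\|x-y\|<1$ is joined by an edge with probability $p$, independently over all such pairs, and no other pairs are joined. The set $S$ is Rado if the resulting graph is almost surely unique up to isomorphism, i.e. two independent samples of $G(S,p)$ are isomorphic (as abstract graphs) with probability $1$. *)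

(* Defs.v *)
From mathcomp Require Import all_boot all_order all_algebra finmap.
From mathcomp Require Import all_classical all_reals all_analysis.

Set Implicit Arguments.
Unset Strict Implicit.
Unset Printing Implicit Defensive.

Import Order.TTheory GRing.Theory Num.Theory.
Import numFieldNormedType.Exports.

Local Open Scope classical_set_scope.
Local Open Scope ring_scope.

Section bases.
Context {R : realType} {X : normedModType R}.

Definition lin_series (e : nat -> X) (a : nat -> R) : nat -> X :=
  series (fun i => a i *: e i).

Definition schauder_basis (e : nat -> X) : Prop :=
  forall x : X, exists! a : nat -> R, lin_series e a @ \oo --> x.

Definition one_symmetric_basis (e : nat -> X) : Prop :=
  schauder_basis e /\
  forall (pi : nat -> nat) (a : nat -> R), bijective pi ->
    cvg (lin_series e a @ \oo) ->
    cvg (lin_series e (a \o pi) @ \oo) /\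
    `|lim (lin_series e a @ \oo)| = `|lim (lin_series e (a \o pi) @ \oo)|.

End bases.

Definition has_1symmetric_basis (R : realType) (X : normedModType R) : Prop :=
  exists e : nat -> X, one_symmetric_basis e.

(* X is linearly isometric to ell_q, the q-summable real sequences; the Lnorm
   for the counting measure is the usual ell_q norm (Lnorm_counting). *)
Definition is_ell (R : realType) (q : R) (X : normedModType R) : Prop :=
  exists T : X -> nat -> R,
    [/\ forall (c : R) (x y : X) i, T (c *: x + y) i = c * T x i + T y i,
        forall x : X, ((`|x|)%:E = 'N[counting]_(q%:E)[EFin \o T x])%E &
        forall a : nat -> R,
          ('N[counting]_(q%:E)[EFin \o a] < +oo)%E -> exists x, T x = a].

Section independence.
Context {d : measure_display} {Omega : measurableType d} {R : realType}.
Variable P : probability Omega R.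

Definition mutually_independent (I : choiceType) (D : set I)
    (E : I -> set Omega) : Prop :=
  forall s : {fset I}, [set` s] `<=` D ->
    P (\bigcap_(i in [set` s]) E i) = (\prod_(i <- s) P (E i))%E.

Definition independent_classes (F1 F2 : set (set Omega)) : Prop :=
  forall A B, F1 A -> F2 B -> P (A `&` B) = (P A * P B)%E.

End independence.

(* A graph is given by its set of edges; an edge is an unordered pair of
   vertices, i.e. a set of the form [set x; y] with x <> y. *)
Definition graph (V : Type) := set (set V).

Definition graph_isomorphic (V : Type) (S : set V) (G H : graph V) : Prop :=
  exists f : V -> V, set_bij S S f /\
    forall x y, S x -> S y -> (G [set x; y] <-> H [set f x; f y]).

Section random_graphs.
Context {R : realType} {X : normedModType R}.

Definition potential_edges (S : set X) : graph X :=
  [set e | exists x y, [/\ S x, S y, x <> y, `|x - y| < 1 & e = [set x; y]]].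

Definition edge_event (Omega : Type) (G : Omega -> graph X) (e : set X) :
  set Omega := [set w | G w e].

(* G is a sample of G(S,p) on the probability space (Omega, P). *)
Definition random_graph (S : set X) (p : R) d (Omega : measurableType d)
    (P : probability Omega R) (G : Omega -> graph X) : Prop :=
  [/\ forall w, G w `<=` potential_edges S,
      forall e, potential_edges S e -> measurable (edge_event G e),
      forall e, potential_edges S e -> P (edge_event G e) = p%:E &
      mutually_independent P (potential_edges S) (edge_event G)].

Definition graph_sigma_algebra (S : set X) (Omega : Type)
    (G : Omega -> graph X) : set (set Omega) :=
  <<s edge_event G @` potential_edges S >>.

(* Measurability of the event "the samples are isomorphic" is not assumed:
   it contains a measurable event of probability 1. *)
Definition Rado (S : set X) (p : R) : Prop :=
  forall (d : measure_display) (Omega : measurableType d)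
    (P : probability Omega R) (G H : Omega -> graph X),
    random_graph S p P G -> random_graph S p P H ->
    independent_classes P (graph_sigma_algebra S G) (graph_sigma_algebra S H) ->
    {ae P, forall w, graph_isomorphic S (G w) (H w)}.

End random_graphs.

(* Main.v *)
Require Import Defs.
From mathcomp Require Import finmap.
From mathcomp Require Import all_boot all_order all_algebra.
From mathcomp Require Import all_classical all_reals all_analysis.
From mathcomp Require Import ring lra.
Import Order.TTheory GRing.Theory Num.Theory.
Import numFieldNormedType.Exports.
Local Open Scope classical_set_scope.
Local Open Scope ring_scope.

(* Permuting coordinates is isometric. The dense set consists of finite rational
   vectors, each perturbed by a small infinite tail on a row of coordinates of
   its own, so that distinct points have almost disjoint supports. Given finitely
   many points and a further point x, a coordinate permutation can fix the former
   and carry x to infinitely many other points of the set, by moving the tail of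
   x to a fresh row. These images are at the same distances from the given
   points as x, and their adjacencies to them are independent, so almost surely
   one of them realizes any prescribed pattern of edges to the points at distance
   less than 1. A back-and-forth argument among finite partial maps induced by
   coordinate permutations then produces an isomorphism. *)

(** * Bijections by back-and-forth *)

Lemma uniq_map_inj (T U : eqType) (h : T -> U) (s : seq T) a b :
  uniq (map h s) -> a \in s -> b \in s -> h a = h b -> a = b.
Proof.
elim: s => //= c s IHs /andP[hc us]; rewrite !inE.
move=> /predU1P[->|as_] /predU1P[->|bs] //; last exact: IHs.
- by move=> hcb; move: hc; rewrite hcb map_f.
- by move=> hca; move: hc; rewrite -hca map_f.
Qed.

Lemma set2_inj (T : Type) (x y x' y' : T) : x <> y' -> y <> x' ->
  [set x; y] = [set x'; y'] -> x = x' /\ y = y'.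
Proof.
move=> xy' yx' eqs.
have : [set x'; y'] x by rewrite -eqs; left.
have : [set x'; y'] y by rewrite -eqs; right.
by case=> // -> [->|].
Qed.

(** Along an enumeration of [T], each element is put into the domain and then into the range; the
    union of the resulting chain of lists is the graph of [f]. The last clause puts any two pairs of
    [f] into one list, so a binary relation respected by all lists is respected by [f]. *)
Lemma back_and_forth (T : countType) (Inv : seq (T * T) -> Prop) :
  Inv [::] ->
  (forall l x, Inv l -> x \notin map fst l -> exists y, Inv ((x, y) :: l)) ->
  (forall l y, Inv l -> y \notin map snd l -> exists x, Inv ((x, y) :: l)) ->
  (forall l, Inv l -> uniq (map fst l) /\ uniq (map snd l)) ->
  exists2 f : T -> T, bijective f &
    forall x y, exists l, [/\ Inv l, (x, f x) \in l & (y, f y) \in l].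
Proof.
move=> Inv0 forth back Inv_uniq.
have step (n : nat) (l : {l | Inv l}) : exists l' : {l | Inv l},
    {subset sval l <= sval l'} /\
    forall x, unpickle n = Some x ->
      x \in map fst (sval l') /\ x \in map snd (sval l').
  case: l => l Hl /=.
  case nx: (unpickle n) => [x|]; last by exists (exist _ l Hl); split.
  have [l1 [Hl1 sl1 xl1]] : exists l1,
      [/\ Inv l1, {subset l <= l1} & x \in map fst l1].
    have [xl|xl] := boolP (x \in map fst l); first by exists l; split.
    have [y Hy] := forth _ _ Hl xl; exists ((x, y) :: l).
    by split; rewrite ?mem_head // => z zl; rewrite inE zl orbT.
  have [l2 [Hl2 sl2 xl2]] : exists l2,
      [/\ Inv l2, {subset l1 <= l2} & x \in map snd l2].
    have [xl|xl] := boolP (x \in map snd l1); first by exists l1; split.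
    have [y Hy] := back _ _ Hl1 xl; exists ((y, x) :: l1).
    by split; rewrite ?mem_head // => z zl; rewrite inE zl orbT.
  exists (exist _ l2 Hl2) => /=; split; first by move=> z /sl1 /sl2.
  move=> _ [<-]; split=> //.
  by move/mapP: xl1 => [z /sl2 zl ->]; apply: map_f.
have [F HF] := choice (fun nl : nat * {l | Inv l} => step nl.1 nl.2).
pose L := fix L n := if n is m.+1 then F (m, L m) else exist _ [::] Inv0.
have Lmono m n : (m <= n)%N -> {subset sval (L m) <= sval (L n)}.
  elim: n => [|n IHn]; first by rewrite leqn0 => /eqP ->.
  rewrite leq_eqVlt => /predU1P[->|]; first by move=> z; exact.
  move=> /IHn sub.
  have [sub' _] := HF (n, L n).
  by move=> z /sub /sub'.
have L1 x : exists y, (x, y) \in sval (L (pickle x).+1).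
  have [_ /(_ x)] := HF (pickle x, L (pickle x)).
  by rewrite pickleK => /(_ erefl)[/mapP[[a b] ab /= xa] _]; exists b; rewrite {1}xa.
have L2 y : exists x, (x, y) \in sval (L (pickle y).+1).
  have [_ /(_ y)] := HF (pickle y, L (pickle y)).
  by rewrite pickleK => /(_ erefl)[_ /mapP[[a b] ab /= yb]]; exists a; rewrite {1}yb.
have common m n z t : z \in sval (L m) -> t \in sval (L n) ->
    exists l, [/\ Inv l, z \in l & t \in l].
  move=> zm tn; exists (sval (L (maxn m n))).
  by split; [exact: svalP | apply: Lmono zm | apply: Lmono tn];
    rewrite ?leq_maxl ?leq_maxr.
have [f Hf] := choice L1; have [g Hg] := choice L2.
exists f.
  exists g => x.
  - have [l [/Inv_uniq[_ u2] a b]] := common _ _ _ _ (Hf x) (Hg (f x)).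
    by have [<-] := uniq_map_inj _ _ _ _ _ _ u2 a b erefl.
  - have [l [/Inv_uniq[u1 _] a b]] := common _ _ _ _ (Hf (g x)) (Hg x).
    by have [->] := uniq_map_inj _ _ _ _ _ _ u1 a b erefl.
by move=> x y; apply: common (Hf x) (Hf y).
Qed.

(** * The points of the dense set *)

(* The label (v, K, m) describes the point whose coordinates are those of the
   rational vector v plus 2^-k at cell k of the row of that label, for k >= K.
   The number m only serves to have infinitely many points for each (v, K). *)
Definition label := (seq rat * nat * nat)%type.

(* The rows [cell q] are disjoint infinite sets of coordinates. *)
Definition cell (q : label) (k : nat) : nat := pickle (q, k).

Definition uncell (i : nat) : option (label * nat) := pickle_inv i.

(** The values 2^-k are summable, so the tail has small norm for large [K], and nonzero, so the row
    can be recognized from it. *)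
Definition row_tail (K : nat) (q : label) (i : nat) : rat :=
  if uncell i is Some (r, k) then
    if (r == q) && (K <= k)%N then 2^-1 ^+ k else 0
  else 0.

Definition coef (q : label) (i : nat) : rat :=
  q.1.1`_i + row_tail q.1.2 q i.

Lemma uncellK q k : uncell (cell q k) = Some (q, k).
Proof. exact: pickleK_inv. Qed.

Lemma row_tail_cell K q r k :
  row_tail K q (cell r k) = if (r == q) && (K <= k)%N then 2^-1 ^+ k else 0.
Proof. by rewrite /row_tail uncellK. Qed.

Variant cell_spec (i : nat) : option (label * nat) -> Prop :=
| CellSpec q k of i = cell q k : cell_spec i (Some (q, k))
| NoCellSpec of (forall q k, i <> cell q k) : cell_spec i None.

Lemma cellP i : cell_spec i (uncell i).
Proof.
case E: (uncell i) => [[q k]|]; constructor.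
  by have := pickle_invK (T := (label * nat)%type) i; rewrite -/(uncell i) E /= /cell => <-.
by move=> q k iE; rewrite iE uncellK in E.
Qed.

Lemma cell_inj q r k j : cell q k = cell r j -> q = r /\ k = j.
Proof. by move=> /(pcan_inj pickleK)[-> ->]. Qed.

(** By induction on [N]: the value [N] is taken at most once, so it suffices to start after that
    index. *)
Lemma inj_eventually_geq (f : nat -> nat) : injective f ->
  forall N, exists K, forall k, (K <= k)%N -> (N <= f k)%N.
Proof.
move=> finj; elim=> [|N [K HK]]; first by exists 0.
have [[j fj]|nj] := pselect (exists j, f j = N).
  exists (maxn K j.+1) => k; rewrite geq_max => /andP[/HK].
  rewrite leq_eqVlt => /orP[/eqP Nk|//]; have := finj k j.
  by rewrite fj -Nk => /(_ erefl) ->; rewrite ltnn.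
exists K => k /HK; rewrite leq_eqVlt => /orP[/eqP Nk|//].
by case: nj; exists k.
Qed.

Lemma cell_eventually_geq q N :
  exists K, forall k, (K <= k)%N -> (N <= cell q k)%N.
Proof. by apply: inj_eventually_geq => k j /cell_inj[]. Qed.

(** By induction on [N]: the coordinate [N] lies in at most one cell, and taking [m] beyond the last
    component of its label leaves it out. *)
Lemma new_cells_geq N : exists m0, forall v K m k,
  (m0 <= m)%N -> (N <= cell (v, K, m) k)%N.
Proof.
elim: N => [|N [m0 Hm0]]; first by exists 0.
case: (cellP N) => [[[v' K'] m'] k' NE|nN].
  exists (maxn m0 m'.+1) => v K m k; rewrite geq_max => /andP[mm m'm].
  rewrite ltn_neqAle Hm0 // andbT; apply/eqP.
  by rewrite NE => /cell_inj[[_ _ mE] _]; rewrite mE ltnn in m'm.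
exists m0 => v K m k mm; rewrite ltn_neqAle Hm0 // andbT.
by apply/eqP => /nN.
Qed.

Lemma coef_other_row c q : q != c ->
  exists K, forall k, (K <= k)%N -> coef q (cell c k) = 0.
Proof.
move=> qc; have [K HK] := cell_eventually_geq c (size q.1.1).
exists K => k /HK sk; rewrite /coef row_tail_cell eq_sym (negbTE qc) addr0.
exact: nth_default.
Qed.

Lemma coef_row c :
  exists K, forall k, (K <= k)%N -> coef c (cell c k) = 2^-1 ^+ k.
Proof.
have [K HK] := cell_eventually_geq c (size c.1.1).
exists (maxn K c.1.2) => k; rewrite geq_max => /andP[/HK sk ck].
by rewrite /coef row_tail_cell eqxx ck /= nth_default ?add0r.
Qed.

(** Far out on the row of [r], the coefficients of any other label vanish, while those of [r] are
    powers of 1/2. *)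
Lemma coef_inj : injective coef.
Proof.
move=> q r qr; apply/eqP; apply: contraT => qr'.
have [K HK] := coef_other_row _ _ qr'; have [K' HK'] := coef_row r.
have := HK (maxn K K') (leq_maxl _ _).
rewrite qr HK' ?leq_maxr // => /eqP.
by rewrite expf_eq0 invr_eq0 pnatr_eq0 andbF.
Qed.

(** * Coordinate permutations and the partial maps they induce on labels *)

(* A general bijection could spread a row over infinitely many rows, and then
   its tail could not be exchanged with the tail of a fresh row. *)
Definition rowlike (g : nat -> nat) := forall q, exists r K,
  forall k, (K <= k)%N -> g (cell q k) = cell r k.

(** Cells before [K] stay put, since in [alike_extend] the point to be moved may have arbitrary
    entries there. *)
Definition swap_rows (r s : label) (K i : nat) : nat :=
  if uncell i is Some (q, k) then
    if (K <= k)%N then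
      if q == r then cell s k else if q == s then cell r k else i
    else i
  else i.

Lemma swap_rowsK r s K : involutive (swap_rows r s K).
Proof.
move=> i; rewrite {2}/swap_rows; case: (cellP i) => [q k iE|ni].
  have [Kk|Kk] := leqP K k; last first.
    by rewrite /swap_rows iE uncellK leqNgt Kk.
  case: eqP => [qr|qr].
    rewrite /swap_rows uncellK Kk eqxx iE qr.
    by case: eqP => [->|].
  case: eqP => [qs|qs]; rewrite /swap_rows.
    by rewrite uncellK Kk eqxx iE qs.
  by rewrite iE uncellK Kk; do 2![case: eqP => //].
by rewrite /swap_rows; case: (cellP i) => // q k /ni.
Qed.

Lemma swap_rows_like r s K : rowlike (swap_rows r s K).
Proof.
move=> q; have [->|qr] := eqVneq q r.
  by exists s, K => k Kk; rewrite /swap_rows uncellK Kk eqxx.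
have [->|qs] := eqVneq q s.
  by exists r, K => k Kk; rewrite /swap_rows uncellK Kk eqxx; case: eqP => [->|].
exists q, K => k Kk.
by rewrite /swap_rows uncellK Kk (negbTE qr) (negbTE qs).
Qed.

Lemma rowlike_comp g h : rowlike g -> rowlike h -> rowlike (g \o h).
Proof.
move=> Hg Hh q; have [r [K HK]] := Hh q; have [s [K' HK']] := Hg r.
exists s, (maxn K K') => k; rewrite geq_max => /andP[Kk K'k] /=.
by rewrite HK // HK'.
Qed.

(** The list is read as a finite partial map from first to second labels, realized by a single
    permutation [g]. The inverse is required to be rowlike too, which makes the notion symmetric. *)
Definition alike (l : seq (label * label)) : Prop :=
  exists g h, [/\ cancel g h, cancel h g, rowlike g, rowlike h &
    forall p, p \in l -> forall i, coef p.2 (g i) = coef p.1 i].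

Lemma alike_nil : alike [::].
Proof. by exists id, id; split=> // q; exists q, 0. Qed.

Definition swap_pairs (l : seq (label * label)) := [seq (p.2, p.1) | p <- l].

Lemma alike_swap l : alike l -> alike (swap_pairs l).
Proof.
move=> [g [h [gh hg Hg Hh gl]]]; exists h, g; split=> // p /mapP[q ql ->] i /=.
by rewrite -(gl _ ql) hg.
Qed.

Lemma eventually_seq (T : eqType) (Q : T -> nat -> Prop) (s : seq T) :
  (forall x, x \in s -> exists K, forall k, (K <= k)%N -> Q x k) ->
  exists K, forall x, x \in s -> forall k, (K <= k)%N -> Q x k.
Proof.
elim: s => [|x s IHs] Hs; first by exists 0.
have [K HK] := IHs (fun y ys => Hs y (@mem_behead _ (x :: s) y ys)).
have [K' HK'] := Hs x (mem_head _ _).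
exists (maxn K K') => y; rewrite inE => /predU1P[->|ys] k;
  rewrite geq_max => /andP[Kk K'k]; [exact: HK'|exact: HK].
Qed.

(* The image under g of the point c agrees, beyond some K, with 2^-k on a single
   row r, so it is a finite vector v plus a tail on r. Exchanging this tail with
   that of the row of (v, K, m), for m large, moves none of the points l.2. *)
Lemma alike_extend (l : seq (label * label)) (c : label) : alike l -> c \notin map fst l ->
  exists v K m0, forall m, (m0 <= m)%N ->
    alike ((c, (v, K, m)) :: l) /\ (v, K, m) \notin map snd l.
Proof.
move=> [g [h [gh hg Hg Hh gl]]] cl.
have [r [K0 HK0]] := Hg c.
have [K1 HK1] := coef_row c.
have [K2 HK2] : exists K, forall p, p \in l -> forall k, (K <= k)%N ->
    coef p.1 (cell c k) = 0.
  apply: (eventually_seq _ (fun p k => coef p.1 (cell c k) = 0)) => p pl.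
  apply: coef_other_row.
  by apply: contraNneq cl => <-; apply: map_f.
pose K := maxn K0 (maxn K1 K2).
have geK k : (K <= k)%N -> [/\ (K0 <= k)%N, (K1 <= k)%N & (K2 <= k)%N].
  by rewrite !geq_max => /andP[-> /andP[-> ->]].
(* These cells of row [r] carry the tail of the image of [c]. Elsewhere the image has finite
   support: its nonzero entries come from the vector of [c] or from cells before [K]. *)
pose in_tail i := if uncell i is Some (q, k) then
  (q == r) && (K <= k)%N else false.
have [N HN] : exists N, forall i, (N <= i)%N -> ~~ in_tail i -> coef c (h i) = 0.
  have [N1 HN1] : exists N, forall j, (j < size c.1.1)%N -> (g j < N)%N.
    exists (\max_(j < size c.1.1) g j).+1 => j jc; rewrite ltnS.
    exact: (leq_bigmax (F := fun j : 'I__ => g j) (Ordinal jc)).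
  have [N2 HN2] : exists N, forall k, (k < K)%N -> (g (cell c k) < N)%N.
    exists (\max_(k < K) g (cell c k)).+1 => k kK; rewrite ltnS.
    exact: (leq_bigmax (F := fun k : 'I__ => g (cell c k)) (Ordinal kK)).
  exists (maxn N1 N2) => i; rewrite geq_max => /andP[N1i N2i] it.
  have ch : (size c.1.1 <= h i)%N.
    by rewrite leqNgt; apply/negP => /HN1; rewrite hg ltnNge N1i.
  rewrite /coef nth_default // add0r.
  rewrite /row_tail; case: (cellP (h i)) => // q k hiE.
  case: eqP => //= qc; rewrite qc in hiE.
  have iE : i = g (cell c k) by rewrite -hiE hg.
  have [kK|Kk] := ltnP k K; first by have := HN2 _ kK; rewrite -iE ltnNge N2i.
  have [K0k _ _] := geK _ Kk.
  by move: it; rewrite /in_tail iE HK0 // uncellK eqxx Kk.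
pose v := mkseq (fun i => if in_tail i then 0 else coef c (h i)) N.
have vE i : v`_i = if in_tail i then 0 else coef c (h i).
  have [iN|Ni] := ltnP i N; first by rewrite nth_mkseq.
  rewrite nth_default ?size_mkseq //; case: ifPn => // /(HN _ Ni) ->//.
(* The bound [m1] puts the new row beyond the vectors of the labels in [map snd l], and [m2] beyond
   [v]; [m3] and [m4] make the new label differ from those labels and from [r]. *)
have [m1 Hm1] := new_cells_geq (\max_(p <- l) size p.2.1.1).
have [m2 Hm2] := new_cells_geq N.
pose m3 := (\max_(p <- l) p.2.2).+1.
pose m4 := r.2.+1.
exists v, K, (maxn (maxn m1 m2) (maxn m3 m4)) => m.
rewrite !geq_max => /andP[/andP[m1m m2m] /andP[m3m m4m]].
set c' := (v, K, m).
have c'l p : p \in l -> p.2 != c'.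
  move=> pl; apply/eqP => pc'.
  have := leq_bigmax_seq (F := fun p : label * label => p.2.2) p pl isT.
  by rewrite pc' /= leqNgt m3m.
have rc' : r != c' by apply/eqP => rc'; move: m4m; rewrite /m4 rc' /= ltnn.
split; last first.
  by apply/negP => /mapP[p /c'l + c'p]; rewrite -c'p eqxx.
pose s := swap_rows r c' K.
exists (s \o g), (h \o s); split.
- by move=> i; rewrite /s /= swap_rowsK gh.
- by move=> i; rewrite /s /= hg swap_rowsK.
- exact/rowlike_comp/Hg/swap_rows_like.
- exact/rowlike_comp/swap_rows_like.
(* After [g], the swap has to carry the image of [c] to the new point and to fix the points already
   in the range of [l]. *)
suff Hs : (forall i, coef c' (s i) = coef c (h i)) /\
          (forall p, p \in l -> forall i, coef p.2 (s i) = coef p.2 i).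
  move=> p; rewrite inE => /predU1P[-> i|pl i] /=.
    by rewrite Hs.1 gh.
  by rewrite Hs.2 // gl.
have vc' k : v`_(cell c' k) = 0.
  by rewrite nth_default // size_mkseq Hm2.
have vr k : (K <= k)%N -> v`_(cell r k) = 0.
  by move=> Kk; rewrite vE /in_tail uncellK eqxx Kk.
split=> [i|p pl i].
  have hr k : (K <= k)%N -> h (cell r k) = cell c k.
    by move=> /geK[K0k _ _]; rewrite -HK0.
  rewrite /s /swap_rows; case: (cellP i) => [q k iE|ni]; last first.
    rewrite /coef /= vE /in_tail /row_tail.
    by case: (cellP i) => [q k /ni //|_]; rewrite addr0.
  have [Kk|kK] := leqP K k; last first.
    rewrite /coef /= iE row_tail_cell [(K <= k)%N]leqNgt kK andbF addr0 vE.
    by rewrite /in_tail uncellK [(K <= k)%N]leqNgt kK andbF.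
  case: eqP => [qr|/eqP qr].
    rewrite /coef /= row_tail_cell eqxx Kk vc' add0r iE qr hr //.
    by have [_ K1k _] := geK _ Kk; have := HK1 _ K1k; rewrite /coef => ->.
  case: eqP => [qc'|/eqP qc'].
    have -> : coef c (h i) = 0.
      have := vc' k; rewrite vE /in_tail uncellK -qc' (negbTE qr) /=.
      by rewrite iE.
    by rewrite /coef /= row_tail_cell (negbTE rc') addr0 vr.
  rewrite /coef /= iE row_tail_cell (negbTE qc') addr0 vE.
  by rewrite /in_tail uncellK (negbTE qr).
(* The point [p.2] vanishes on both exchanged parts: on the new row by the choice of [m], and on row
   [r] because [g] brings these cells from row [c], where [p.1] vanishes far out. *)
have pc' k : coef p.2 (cell c' k) = 0.
  rewrite /coef row_tail_cell eq_sym (negbTE (c'l _ pl)) addr0 nth_default //.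
  apply: leq_trans (Hm1 _ _ _ _ m1m).
  exact: (leq_bigmax_seq (F := fun p : label * label => size p.2.1.1) p pl isT).
have pr k : (K <= k)%N -> coef p.2 (cell r k) = 0.
  by move=> /geK[K0k _ K2k]; rewrite -HK0 // gl // HK2.
rewrite /s /swap_rows; case: (cellP i) => [q k iE|//].
case: leqP => [Kk|//].
case: eqP => [qr|_]; first by rewrite pc' iE qr (pr _ Kk).
by case: eqP => [qc'|//]; rewrite (pr _ Kk) iE qc' pc'.
Qed.

(** * Independent trials *)

Section independent_trials.
Context {d : measure_display} {Omega : measurableType d} {R : realType}.
Variable P : probability Omega R.
Context {I : choiceType}.
Variables (D : set I) (E : I -> set Omega) (p : R).
Hypothesis mE : forall i, D i -> measurable (E i).
Hypothesis PE : forall i, D i -> P (E i) = p%:E.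
Hypothesis indE : mutually_independent P D E.

Definition literal (x : I * bool) : set Omega := if x.2 then E x.1 else ~` E x.1.

Definition cylinder (L : seq (I * bool)) : set Omega :=
  \big[setI/setT]_(x <- L) literal x.

Definition literal_weight (b : bool) : R := if b then p else 1 - p.

(** The probability of the cylinder, when its indices are distinct and in [D]. *)
Definition cylinder_weight (L : seq (I * bool)) : R :=
  \prod_(x <- L) literal_weight x.2.

Definition avoid (Bs : seq (seq (I * bool))) : set Omega :=
  \big[setI/setT]_(B <- Bs) ~` cylinder B.

Lemma cylinder_cons x L : cylinder (x :: L) = literal x `&` cylinder L.
Proof. by rewrite /cylinder big_cons. Qed.

Lemma cylinder_cat L L' : cylinder (L ++ L') = cylinder L `&` cylinder L'.
Proof. by rewrite /cylinder big_cat. Qed.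

Lemma cylinderP L w : cylinder L w <->
  forall x, x \in L -> (E x.1 w <-> x.2).
Proof.
have literalP x : literal x w <-> (E x.1 w <-> x.2).
  rewrite /literal; case: x.2; first by split=> [|[_]] //; exact.
  by split=> [nE|[nE _] /nE].
by rewrite /cylinder -bigcap_seq; split=> H x xL; apply/literalP; exact: H.
Qed.

Lemma avoidP Bs w : avoid Bs w <-> forall B, B \in Bs -> ~ cylinder B w.
Proof. by rewrite /avoid -bigcap_seq. Qed.

Lemma measurable_cylinder (L : seq (I * bool)) : (forall x, x \in L -> D x.1) ->
  measurable (cylinder L).
Proof.
move=> LD; rewrite /cylinder big_seq; apply: big_ind => //.
  exact: measurableI.
move=> [i []] /LD /mE Ei; rewrite /literal //=; exact: measurableC.
Qed.

Lemma measurable_avoid (Bs : seq (seq (I * bool))) :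
  (forall B x, B \in Bs -> x \in B -> D x.1) -> measurable (avoid Bs).
Proof.
move=> BD; rewrite /avoid big_seq; apply: big_ind => //.
  exact: measurableI.
by move=> B BBs; apply/measurableC/measurable_cylinder => x; exact: BD.
Qed.

Lemma prob_setD (A B : set Omega) (x y : R) : measurable A -> measurable B ->
  P A = y%:E -> P (A `&` B) = x%:E -> P (A `\` B) = (y - x)%:E.
Proof.
move=> mA mB PA PAB.
have PD : P A = (P (A `\` B) + P (A `&` B))%E by exact: measureDI.
by rewrite EFinB -PA PD -PAB addeK // PAB.
Qed.

Lemma prob_positive (s : seq I) : uniq s -> (forall i, i \in s -> D i) ->
  P (cylinder [seq (i, true) | i <- s]) = (p ^+ size s)%:E.
Proof.
move=> us sD; have := indE [fset i in s]%fset.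
have ss : perm_eq [fset i in s]%fset s.
  by apply: uniq_perm => // i; rewrite !inE.
rewrite (perm_big _ ss) /= => ind.
have -> : cylinder [seq (i, true) | i <- s] =
    \bigcap_(i in [set` [fset i in s]%fset]) E i.
  by rewrite bigcap_seq (perm_big _ ss) /= /cylinder big_map.
rewrite ind; last by move=> i /=; rewrite inE => /sD.
rewrite big_seq (eq_bigr (fun=> p%:E)) => [|i /sD /PE //].
by rewrite -big_seq prodEFin big_const_seq count_predT -Monoid.iteropE.
Qed.

(** Independence speaks of intersections of the [E i] only. A complement is handled by subtracting
    the probability of the part inside [E i]; the list [s] collects the events that occur
    positively. *)
Lemma prob_cylinder_positive (s : seq I) L : uniq (s ++ map fst L) ->
  (forall i, i \in s ++ map fst L -> D i) ->
  P (cylinder [seq (i, true) | i <- s] `&` cylinder L) =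
  (p ^+ size s * cylinder_weight L)%:E.
Proof.
elim: L s => [|[i b] L IHL] s us sD.
  rewrite cats0 in us sD.
  by rewrite /cylinder_weight /cylinder !big_nil setIT mulr1 prob_positive.
have us' : uniq ((i :: s) ++ map fst L).
  by move: us; rewrite /= !cat_uniq /= mem_cat !negb_or -!andbA => /and5P[-> -> -> -> ->].
have sD' j : j \in (i :: s) ++ map fst L -> D j.
  move=> jL; apply: sD; move: jL; rewrite !(mem_cat, inE) /=.
  by case/orP => [/orP[]|] ->; rewrite ?orbT.
have us'' : uniq (s ++ map fst L) by case/andP: us'.
have sD'' j : j \in s ++ map fst L -> D j.
  by move=> jL; apply: sD'; rewrite inE jL orbT.
have PI := IHL _ us' sD'; rewrite /= cylinder_cons {1}/literal /= in PI.
rewrite cylinder_cons {1}/literal /= /cylinder_weight big_cons -/(cylinder_weight L) /=.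
case: b {us sD}.
  by rewrite setICA setIA PI /literal_weight exprS; congr EFin; ring.
set A := cylinder [seq _ | _ <- _] in PI *; set B := cylinder L in PI *.
have -> : A `&` (~` E i `&` B) = (A `&` B) `\` E i.
  by rewrite setDE setICA setIC.
have -> : p ^+ size s * (literal_weight false * cylinder_weight L) =
    p ^+ size s * cylinder_weight L - p ^+ (size s).+1 * cylinder_weight L.
  by rewrite /literal_weight exprS; ring.
apply: prob_setD.
- apply: measurableI; apply: measurable_cylinder.
    by move=> x /mapP[j js ->]; apply: sD''; rewrite mem_cat js.
  by move=> x xL; apply: sD''; rewrite mem_cat map_f ?orbT.
- by apply/mE/sD'; rewrite mem_head.
- exact: IHL.
- by rewrite -PI; congr (P _); rewrite setIC setIA.
Qed.

(** Avoiding [B] is again a subtraction, with [B] appended to [L] in the subtracted term; as the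
    indices are distinct, the weights multiply. *)
Lemma prob_cylinder_avoid (L : seq (I * bool)) (Bs : seq (seq (I * bool))) : uniq (map fst (L ++ flatten Bs)) ->
  (forall x, x \in L ++ flatten Bs -> D x.1) ->
  P (cylinder L `&` avoid Bs) =
  (cylinder_weight L * \prod_(B <- Bs) (1 - cylinder_weight B))%:E.
Proof.
elim: Bs L => [|B Bs IHBs] L uL LD.
  rewrite /avoid !big_nil setIT mulr1.
  have := prob_cylinder_positive [::] L; rewrite cats0 in uL LD.
  rewrite /= {1}/cylinder big_nil setTI mul1r; apply=> // i /mapP[x xL ->].
  exact: LD.
have -> : cylinder L `&` avoid (B :: Bs) =
    (cylinder L `&` avoid Bs) `\` cylinder B.
  by rewrite /avoid big_cons -/(avoid Bs) setDE [~` _ `&` _]setIC setIA.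
have PB : P (cylinder (L ++ B) `&` avoid Bs) = (cylinder_weight (L ++ B) *
    \prod_(B <- Bs) (1 - cylinder_weight B))%:E.
  by apply: IHBs; rewrite -catA.
have uL' : uniq (map fst (L ++ flatten Bs)).
  move: uL; apply: subseq_uniq; apply: map_subseq; apply: cat_subseq => //.
  exact: suffix_subseq.
have LD' x : x \in L ++ flatten Bs -> D x.1.
  by move=> xL; apply: LD; move: xL; rewrite /= !mem_cat => /orP[] ->; rewrite ?orbT.
rewrite big_cons.
have -> : cylinder_weight L * ((1 - cylinder_weight B) *
      \prod_(B <- Bs) (1 - cylinder_weight B)) =
    cylinder_weight L * \prod_(B <- Bs) (1 - cylinder_weight B) -
    cylinder_weight (L ++ B) * \prod_(B <- Bs) (1 - cylinder_weight B).
  have -> : cylinder_weight (L ++ B) = cylinder_weight L * cylinder_weight B.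
    by rewrite /cylinder_weight big_cat.
  by ring.
apply: prob_setD.
- apply: measurableI.
    by apply: measurable_cylinder => x xL; apply: LD'; rewrite mem_cat xL.
  apply: measurable_avoid => B' x B'Bs xB'; apply: LD'.
  by rewrite mem_cat; apply/orP; right; apply/flattenP; exists B'.
- apply: measurable_cylinder => x xB.
  by apply: LD; rewrite /= !mem_cat xB orbT.
- exact: IHBs.
- by rewrite -PB cylinder_cat setIAC.
Qed.

Hypothesis p01 : 0 < p < 1.

Lemma cylinder_weight_gt0 L : 0 < cylinder_weight L.
Proof.
apply: prodr_gt0 => x _; rewrite /literal_weight.
by move: p01 => /andP[p0 p1]; case: x.2; rewrite ?subr_gt0.
Qed.

Lemma cylinder_weight_le1 L : cylinder_weight L <= 1.
Proof.
apply: prodr_ile1 => x _; rewrite /literal_weight.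
by move: p01 => /andP[p0 p1]; case: x.2; apply/andP; split; lra.
Qed.

(** The trials use disjoint sets of indices, so the first [n] all fail with probability (1 - c)^n,
    which tends to 0 because 0 < c <= 1. *)
Lemma negligible_all_trials_fail (B : nat -> seq (I * bool)) (c : R) :
  (forall j, cylinder_weight (B j) = c) ->
  (forall j x, x \in B j -> D x.1) ->
  (forall n, uniq (map fst (flatten (mkseq B n)))) ->
  P.-negligible [set w | forall j, ~ cylinder (B j) w].
Proof.
move=> Bc BD uB.
have mC j : measurable (cylinder (B j)) by apply/measurable_cylinder/BD.
pose A := \bigcap_j ~` cylinder (B j).
have mA : measurable A by apply: bigcapT_measurable => j; exact: measurableC.
have PA n : (P A <= ((1 - c) ^+ n)%:E)%E.
  have BDn x : x \in flatten (mkseq B n) -> D x.1.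
    by move/flattenP => [_ /mapP[j _ ->] xB]; exact: BD xB.
  have := prob_cylinder_avoid [::] (mkseq B n) (uB n) BDn.
  rewrite /cylinder_weight {1}/cylinder !big_nil setTI mul1r big_map.
  rewrite (eq_bigr (fun=> 1 - c)) => [|j _]; last by rewrite -(Bc j).
  rewrite big_const_seq count_predT size_iota iter_mulr_1 => <-.
  apply: le_measure; rewrite ?inE //.
    by apply: measurable_avoid => B' x /mapP[j _ ->]; exact: BD.
  by move=> w Aw; apply/avoidP => B' /mapP[j _ ->]; exact: Aw.
have c01 : `|1 - c| < 1.
  have := cylinder_weight_gt0 (B 0); have := cylinder_weight_le1 (B 0).
  by rewrite Bc => c1 c0; rewrite ger0_norm; lra.
exists A; split=> //; last by move=> w Hw j _; exact: Hw.
apply/eqP; rewrite eq_le measure_ge0 andbT.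
have PAfin : P A \is a fin_num by exact: fin_num_measure.
rewrite -(fineK PAfin) lee_fin.
apply: (ler_cvg_to (cvg_cst (fine (P A))) (cvg_expr c01)).
by apply: nearW => n; rewrite -lee_fin fineK.
Qed.

End independent_trials.

(** * Rado sets from symmetric bases *)

Section lin_series_theory.
Context {R : realType} {X : normedModType R}.
Implicit Types (e : nat -> X) (a b : nat -> R).

Lemma lin_seriesB e a b :
  lin_series e (fun i => a i - b i) = lin_series e a \- lin_series e b.
Proof.
apply/funext => n; rewrite /lin_series /series /= -sumrB.
by apply: eq_bigr => i _; rewrite scalerBl.
Qed.

Lemma lin_seriesD e a b :
  lin_series e (fun i => a i + b i) = lin_series e a \+ lin_series e b.
Proof.
apply/funext => n; rewrite /lin_series /series /= -big_split /=.
by apply: eq_bigr => i _; rewrite scalerDl.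
Qed.

Lemma cvg_lin_series_finite e a N : (forall i, (N <= i)%N -> a i = 0) ->
  lin_series e a @ \oo --> lin_series e a N.
Proof.
move=> a0; apply: cvg_near_cst; near=> n.
have Nn : (N <= n)%N by near: n; exists N.
rewrite /lin_series /series /= (big_cat_nat (leq0n N) Nn) /= [X in _ + X]big_nat.
rewrite [X in _ + X]big1 ?addr0 // => i /andP[/a0 -> _].
by rewrite scale0r.
Unshelve. all: by end_near. Qed.

Lemma norm_lin_series_le e a (C : R) n : (forall i, `|e i| <= C) ->
  `|lin_series e a n| <= (\sum_(0 <= i < n) `|a i|) * C.
Proof.
move=> eC; rewrite /lin_series /series /= mulr_suml.
apply: le_trans (ler_norm_sum _ _ _) _.
by apply: ler_sum => i _; rewrite normrZ ler_wpM2l.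
Qed.

End lin_series_theory.

Lemma norm_lim_le (R : realType) (X : normedModType R) (u : nat -> X) (x : X)
  (M : R) : u @ \oo --> x -> (forall n, `|u n| <= M) -> `|x| <= M.
Proof.
move=> ux uM.
apply: (ler_cvg_to (cvg_norm ux) (cvg_cst M)).
exact: nearW.
Qed.

(** Completeness of [X] enters here: the series converges absolutely, as the [e i] are bounded. *)
Lemma absolutely_cvg_lin_series (R : realType) (X : completeNormedModType R)
    (e : nat -> X) (a : nat -> R) (C M : R) :
  (forall i, `|e i| <= C) -> (forall n, \sum_(0 <= i < n) `|a i| <= M) ->
  cvg (lin_series e a @ \oo).
Proof.
move=> eC aM; apply: normed_cvg.
have C0 : 0 <= C by apply: le_trans (eC 0).
apply: nondecreasing_is_cvgn.
  by apply/nondecreasing_seqP => n; rewrite /= /series /= big_nat_recr //= lerDl.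
exists (M * C) => _ [n _ <-]; rewrite /= /series /=.
apply: (le_trans _ (ler_wpM2r C0 (aM n))); rewrite mulr_suml.
by apply: ler_sum => i _; rewrite normrZ ler_wpM2l.
Qed.

(** A geometric sum; the maximum covers the case M <= K, where both sides are 0. *)
Lemma sum_pow_half_le (K M : nat) :
  \sum_(0 <= k < M) (if (K <= k)%N then 2^-1 ^+ k else 0) =
  2 * 2^-1 ^+ K - 2 * 2^-1 ^+ (maxn M K) :> rat.
Proof.
elim: M => [|M IHM]; first by rewrite big_nil max0n subrr.
rewrite big_nat_recr //= IHM; have [KM|MK] := boolP (K <= M)%N.
  rewrite (maxn_idPl KM) (maxn_idPl (leqW KM)) exprS; set t := 2^-1 ^+ M; by lra.
by rewrite -ltnNge in MK; rewrite (maxn_idPr MK) (maxn_idPr (ltnW MK)) addr0.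
Qed.

Lemma row_tail_ge0 K q i : 0 <= row_tail K q i.
Proof.
rewrite /row_tail; case: uncell => [[r k]|//]; by case: ifP.
Qed.

(** The partial sum becomes a double sum over coordinates and cells. After exchanging the sums, each
    cell counts at most once, which leaves a geometric sum. *)
Lemma sum_row_tail_le K q n :
  \sum_(0 <= i < n) row_tail K q i <= 2 * 2^-1 ^+ K.
Proof.
(* Cells from [M] on lie at coordinates at least [n], outside the partial sum. *)
have [M HM] := cell_eventually_geq q n.
have tailE i : (i < n)%N -> row_tail K q i = \sum_(0 <= k < M)
    (i == cell q k)%:R * (if (K <= k)%N then 2^-1 ^+ k else 0).
  move=> lin; rewrite /row_tail; case: (cellP i) => [r k iE|ni]; last first.
    rewrite big1 // => k _; case: eqP => [/ni //|_]; by rewrite mul0r.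
  have [rq|rq] /= := eqVneq r q; last first.
    rewrite big1 // => j _; case: eqP => [|_]; last by rewrite mul0r.
    by rewrite iE => /cell_inj[/eqP]; rewrite (negbTE rq).
  have kM : (k < M)%N.
    by rewrite ltnNge; apply/negP => /HM; rewrite -rq -iE leqNgt lin.
  rewrite (bigD1_seq k) ?mem_index_iota ?iota_uniq //= iE rq eqxx mul1r.
  rewrite [X in _ + X]big1 ?addr0 // => j jk; case: eqP => [|_]; last by rewrite mul0r.
  by move=> /cell_inj[_ kj]; rewrite kj eqxx in jk.
rewrite big_nat (eq_bigr _ (fun i Hi => tailE i (andP Hi).2)) -big_nat.
rewrite exchange_big /=.
apply: (@le_trans _ _ (\sum_(0 <= k < M) (if (K <= k)%N then 2^-1 ^+ k else 0))).
  apply: ler_sum => k _; rewrite -mulr_suml ler_piMl //.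
    by case: ifP => // _; rewrite exprn_ge0.
  have [rn|rn] := ltnP (cell q k) n.
    rewrite (bigD1_seq (cell q k)) ?mem_index_iota ?iota_uniq //= eqxx.
    by rewrite big1 ?addr0 // => i /negbTE ->.
  rewrite big_nat big1 // => i /andP[_ lin]; case: eqP => // irow.
  by move: lin; rewrite irow ltnNge rn.
by rewrite sum_pow_half_le gerBl mulr_ge0 // exprn_ge0.
Qed.

(** * The points in the Banach space and their density *)

Section points.
Context {R : realType} {X : completeNormedModType R}.
Variable e : nat -> X.
Hypothesis e_basis : one_symmetric_basis e.

(** The transposition of 0 and [i] exchanges the coefficient sequences of [e 0] and [e i]. *)
Lemma norm_basis i : `|e i| = `|e 0|.
Proof.
have cvg_delta j : lin_series e (fun i => (i == j)%:R) @ \oo --> e j.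
  have := @cvg_lin_series_finite _ _ e (fun i => (i == j)%:R) j.+1.
  rewrite {2}/lin_series /series /= big_nat_recr //= eqxx scale1r.
  rewrite big_nat big1 ?add0r => [|k /andP[_ kj]]; first last.
    by rewrite (ltn_eqF kj) scale0r.
  by apply=> k jk; rewrite gtn_eqF.
have swapK : involutive (fun k => if k == 0%N then i else if k == i then 0%N else k).
  move=> k; case: (eqVneq k 0%N) => [->|k0].
    by rewrite eqxx; case: eqP.
  case: (eqVneq k i) => [->//|ki].
  by rewrite (negbTE k0) (negbTE ki).
have [_ sym] := e_basis.
have := sym _ _ (inv_bij swapK) (cvgP _ (cvg_delta i)).
rewrite (cvg_lim _ (cvg_delta i)) //.
have -> : (fun k => (k == i)%:R) \o
    (fun k => if k == 0%N then i else if k == i then 0%N else k) =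
    (fun k => (k == 0%N)%:R : R).
  apply/funext => k /=; congr (_%:R).
  case: (eqVneq k 0%N) => [|k0]; first by rewrite eqxx.
  by case: (eqVneq k i) => [ki|/negbTE -> //]; rewrite eq_sym -ki (negbTE k0).
by rewrite (cvg_lim _ (cvg_delta 0%N)) // => -[].
Qed.

Lemma cvg_row_tail K q :
  cvg (lin_series e (fun i => ratr (row_tail K q i) : R) @ \oo) /\
  `|lim (lin_series e (fun i => ratr (row_tail K q i) : R) @ \oo)| <=
    2 * 2^-1 ^+ K * `|e 0|.
Proof.
have sum_le n : \sum_(0 <= i < n) `|ratr (row_tail K q i) : R| <= 2 * 2^-1 ^+ K.
  have -> : 2 * 2^-1 ^+ K = ratr (2 * 2^-1 ^+ K) :> R.
    by rewrite rmorphM rmorphXn /= fmorphV /= ratr_nat.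
  rewrite (eq_bigr (fun i => ratr (row_tail K q i))) => [|i _]; last first.
    by rewrite ger0_norm // ler0q row_tail_ge0.
  by rewrite -rmorph_sum ler_rat sum_row_tail_le.
have eC i : `|e i| <= `|e 0| by rewrite norm_basis.
have tail_cvg := absolutely_cvg_lin_series _ _ _ _ _ _ eC sum_le.
split=> //; apply: norm_lim_le _ _ _ _ _ tail_cvg _ => n.
apply: le_trans (norm_lin_series_le _ _ _ _ eC) _.
by rewrite ler_wpM2r.
Qed.

Definition point (q : label) : X := lim (lin_series e (fun i => ratr (coef q i)) @ \oo).

Lemma point_cvg_split q :
  lin_series e (fun i => ratr (coef q i)) @ \oo -->
  \sum_(0 <= i < size q.1.1) ratr (q.1.1`_i) *: e i +
  lim (lin_series e (fun i => ratr (row_tail q.1.2 q i)) @ \oo).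
Proof.
have -> : (fun i => ratr (coef q i) : R) =
    (fun i => ratr (q.1.1`_i) + ratr (row_tail q.1.2 q i)).
  by apply/funext => i; rewrite /coef rmorphD.
rewrite lin_seriesD; apply: cvgD; last by have [] := cvg_row_tail q.1.2 q.
apply: cvg_lin_series_finite => i si.
by rewrite nth_default // rmorph0.
Qed.

Lemma point_cvg q : lin_series e (fun i => ratr (coef q i)) @ \oo --> point q.
Proof. exact: cvgP (point_cvg_split q). Qed.

Lemma pointE q : point q =
  \sum_(0 <= i < size q.1.1) ratr (q.1.1`_i) *: e i +
  lim (lin_series e (fun i => ratr (row_tail q.1.2 q i)) @ \oo).
Proof. exact/cvg_lim/point_cvg_split. Qed.

(** Uniqueness of expansions in the basis reduces this to [coef_inj]. *)
Lemma point_inj : injective point.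
Proof.
move=> q r qr; apply: coef_inj.
have [/(_ (point q))[a [_ ua]] _] := e_basis.
have qa := ua _ (point_cvg q); have := point_cvg r; rewrite -qr => /ua ra.
apply/funext => i; apply: (fmorph_inj (ratr : rat -> R)).
by rewrite -[LHS]/((fun i => ratr (coef q i) : R) i) -qa ra.
Qed.

Lemma norm_permuted (a b : nat -> R) (x y : X) (g : nat -> nat) :
  bijective g -> (forall i, b i = a (g i)) ->
  lin_series e a @ \oo --> x -> lin_series e b @ \oo --> y -> `|x| = `|y|.
Proof.
move=> bij_g ba ax; have -> : b = a \o g by apply/funext.
move=> bx; have [_ sym] := e_basis; have [_] := sym _ _ bij_g (cvgP _ ax).
by rewrite (cvg_lim (@norm_hausdorff _ _) ax) (cvg_lim (@norm_hausdorff _ _) bx).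
Qed.

(** The two differences have the same coefficients up to the permutation [g], so 1-symmetry gives
    them the same norm. *)
Lemma alike_isometry l a b : alike l -> a \in l -> b \in l ->
  `|point a.2 - point b.2| = `|point a.1 - point b.1|.
Proof.
move=> [g [h [gh hg _ _ gl]]] al bl.
have pointB q r : lin_series e (fun i => ratr (coef q i) - ratr (coef r i)) @ \oo
    --> point q - point r.
  by rewrite lin_seriesB; apply: cvgB; exact: point_cvg.
have bij_g : bijective g by exists h.
apply: norm_permuted bij_g _ (pointB _ _) (pointB _ _) => i.
by rewrite (gl _ al) (gl _ bl).
Qed.

(** Three errors share [eps]: truncating the expansion, making its coefficients rational, and adding
    the tail. *)
Lemma dense_points : dense (range point).
Proof.
move=> O [x Ox] oO.
have /nbhs_ballP[eps /= eps0 xO] : nbhs x O by exact: open_nbhs_nbhs.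
have [/(_ x)[a [ax _]] _] := e_basis.
have e30 : 0 < eps / 3 by rewrite divr_gt0.
have /cvgrPdist_lt /(_ _ e30) [n _ Hn] := ax.
have {}Hn := Hn n (leqnn n).
have C0 : 0 < `|e 0| + 1 by rewrite ltr_wpDl.
(* With this bound, [n] coefficient errors times the norm of [e 0] stay within eps / 3; the added
   ones keep the denominator positive. *)
pose delta := eps / 3 / (n.+1%:R * (`|e 0| + 1)).
have delta0 : 0 < delta by rewrite divr_gt0 // mulr_gt0.
have [f Hf] : exists f : nat -> rat, forall i, `|a i - ratr (f i)| < delta.
  have /choice[f Hf] : forall i, exists r : rat, `|a i - ratr r| < delta.
    move=> i; have ltd : a i - delta < a i + delta by lra.
    have [r] := rat_in_itvoo ltd; rewrite in_itv /= => Hr.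
    by exists r; rewrite distrC ltr_distl.
  by exists f.
have [K HK] : exists K : nat, 2 * 2^-1 ^+ K * `|e 0| < eps / 3.
  have half1 : `|2^-1 : R| < 1 by rewrite ger0_norm; lra.
  have d0 : 0 < eps / 3 / (2 * (`|e 0| + 1)) by rewrite divr_gt0 // mulr_gt0.
  have /cvgrPdist_lt /(_ _ d0) [K _ HK] := cvg_expr half1.
  exists K; have := HK K (leqnn K); rewrite /= sub0r normrN ger0_norm ?exprn_ge0 //.
  rewrite ltr_pdivlMr ?mulr_gt0 //; apply: le_lt_trans.
  rewrite mulrCA -!mulrA ler_wpM2l // ler_wpM2l ?exprn_ge0 // lerDl //.
pose q : label := (mkseq f n, K, 0%N).
exists (point q); split; last by exists q.
apply: xO; rewrite -ball_normE /= pointE /= size_mkseq.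
have [_] := cvg_row_tail K q; set t := lim _ => tle.
rewrite opprD addrA.
apply: le_lt_trans (ler_normB _ _) _.
have -> : x - \sum_(0 <= i < n) ratr (mkseq f n)`_i *: e i =
    (x - lin_series e a n) + lin_series e (fun i => a i - ratr (f i)) n.
  rewrite lin_seriesB /= addrA subrK; congr (_ - _).
  by apply: eq_big_nat => i /andP[_ lin]; rewrite nth_mkseq.
have eC i : `|e i| <= `|e 0| by rewrite norm_basis.
have := @norm_lin_series_le _ _ e (fun i => a i - ratr (f i)) _ n eC.
have le3 : (\sum_(0 <= i < n) `|a i - ratr (f i)|) * `|e 0| <= eps / 3.
  apply: (@le_trans _ _ (n.+1%:R * delta * (`|e 0| + 1))).
    apply: ler_pM => //; [exact: sumr_ge0|  |by rewrite lerDl].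
    apply: (@le_trans _ _ (\sum_(0 <= i < n) delta)).
      by apply: ler_sum => i _; exact: ltW.
    rewrite sumr_const_nat subn0 -[leLHS]mulr_natl ler_wpM2r ?ler_nat //.
    exact: ltW.
  by rewrite mulrAC mulrC /delta divfK // mulf_neq0 ?pnatr_eq0 // gt_eqF.
move=> le3'.
apply: (@le_lt_trans _ _ (`|x - lin_series e a n| +
  `|lin_series e (fun i => a i - ratr (f i)) n| + `|t|)).
  by rewrite lerD2r ler_normD.
lra.
Qed.

(** * Almost sure genericity *)

(** An extension property as for the Rado graph: a partial map extends to [c] with any prescribed
    adjacencies to the points at distance less than 1. As [A] is a list, there are only countably
    many instances. *)
Definition generic (G : graph X) : Prop :=
  forall l c A, alike l -> uniq (map snd l) -> c \notin map fst l ->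
  exists c', [/\ alike ((c, c') :: l), c' \notin map snd l &
    forall x, x \in l -> `|point c - point x.1| < 1 ->
      (G [set point c'; point x.2] <-> x.2 \in (A : seq label))].

Section generic_ae.
Context {d : measure_display} {Omega : measurableType d}.
Variables (P : probability Omega R) (p : R) (G : Omega -> graph X).
Hypothesis p01 : 0 < p < 1.
Hypothesis randomG : random_graph (range point) p P G.

(** The candidates [q j] from [alike_extend] have the right distances, so the pairs to be prescribed
    are potential edges. Different candidates use different edges, which gives independent trials
    with the same positive probability of success. *)
Lemma extension_fails_negligible l c (A : seq label) :
  alike l -> uniq (map snd l) -> c \notin map fst l ->
  P.-negligible [set w | ~ exists c', [/\ alike ((c, c') :: l),
    c' \notin map snd l &
    forall x, x \in l -> `|point c - point x.1| < 1 ->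
      (G w [set point c'; point x.2] <-> x.2 \in A)]].
Proof.
move=> sim_l ul cl; have [GS mG PG indG] := randomG.
have [v [K [m0 Hm]]] := alike_extend _ _ sim_l cl.
pose q j : label := (v, K, (m0 + j)%N).
have [simq ql] : (forall j, alike ((c, q j) :: l)) /\
    (forall j, q j \notin map snd l).
  by split=> j; have [] := Hm (m0 + j)%N (leq_addr _ _).
pose near_l := [seq x <- l | `|point c - point x.1| < 1].
pose edge j (x : label * label) := [set point (q j); point x.2].
pose B j := [seq (edge j x, x.2 \in A) | x <- near_l].
have qx j x : x \in l -> q j <> x.2.
  by move=> xl qE; have := ql j; rewrite qE map_f.
have negl : P.-negligible [set w | forall j, ~ cylinder (edge_event G) (B j) w].
  apply: (negligible_all_trials_fail P (potential_edges (range point))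
    (edge_event G) p mG PG indG p01 B
    (\prod_(x <- near_l) literal_weight p (x.2 \in A))).
  - by move=> j; rewrite /cylinder_weight /B big_map.
  - move=> j _ /mapP[x + ->] /=; rewrite mem_filter => /andP[cx xl].
    exists (point (q j)), (point x.2); split=> //.
    + by move=> /point_inj; exact: qx.
    + have := alike_isometry _ (c, q j) x (simq j) (mem_head _ _).
      by rewrite inE xl orbT => ->.
  - move=> n; have -> : map fst (flatten (mkseq B n)) =
        [seq edge j x | j <- iota 0 n, x <- near_l].
      rewrite map_flatten /mkseq -map_comp; congr flatten.
      by apply: eq_map => j /=; rewrite /B -map_comp.
    apply: allpairs_uniq; first exact: iota_uniq.
      exact/filter_uniq/(map_uniq ul).
    move=> _ _ /allpairsP[[j x] /= [_ xl ->]] /allpairsP[[k y] /= [_ yl ->]] /=.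
    move: xl yl; rewrite !mem_filter => /andP[_ xl] /andP[_ yl].
    (* No candidate occurs among the second labels of [l], so equal edges can only match candidate
       with candidate. *)
    move=> exy; have [||/point_inj[/addnI ->] /point_inj xy] := set2_inj _ _ _ _ _ _ _ exy.
    + by move=> /point_inj; exact: qx.
    + by move=> /point_inj /esym; exact: qx.
    + by rewrite (uniq_map_inj _ _ _ _ _ _ ul xl yl xy).
apply: negligibleS negl => w /= Hw j Bj; apply: Hw.
exists (q j); split=> // x xl cx.
have /cylinderP/(_ (edge j x, x.2 \in A)) := Bj; apply.
by apply: map_f; rewrite mem_filter cx.
Qed.

(** The instances are enumerated by their codes, and a countable union of negligible sets is
    negligible. *)
Lemma generic_ae : {ae P, forall w, generic (G w)}.
Proof.
pose ext w (t : seq (label * label) * label * seq label) :=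
  let: (l, c, A) := t in
  alike l -> uniq (map snd l) -> c \notin map fst l ->
  exists c', [/\ alike ((c, c') :: l), c' \notin map snd l &
    forall x, x \in l -> `|point c - point x.1| < 1 ->
      (G w [set point c'; point x.2] <-> x.2 \in A)].
have ae_ext : {ae P, forall w, forall n,
    forall t, unpickle n = Some t -> ext w t}.
  apply: ae_foralln => n.
  case nt: (unpickle n) => [[[l c] A]|]; last exact: aeW.
  suff : {ae P, forall w, ext w (l, c, A)} by apply: filterS => w Hw _ [<-].
  have [[sim_l ul cl]|nH] := pselect [/\ alike l, uniq (map snd l) & c \notin map fst l].
    have := extension_fails_negligible l c A sim_l ul cl.
    apply: negligibleS => w /= Hw Hex; apply: Hw => _ _ _; exact: Hex.
  by apply: aeW => w /= sim_l ul cl; case: nH.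
apply: filterS ae_ext => w Hw l c A.
exact: Hw (pickle (l, c, A)) _ (pickleK _).
Qed.

End generic_ae.

(** * Isomorphism of generic graphs *)

Lemma potential_edgeP (S : set X) x y :
  potential_edges S [set x; y] -> x <> y /\ `|x - y| < 1.
Proof.
move=> [a [b [_ _ nab ab xy]]].
have xa : [set x; y] a by rewrite xy; left.
have xb : [set x; y] b by rewrite xy; right.
case: xa xb => /= aE [|] /= bE; subst a b => //.
by split; [exact/nesym|rewrite distrC].
Qed.

Definition partial_iso (G H : graph X) (l : seq (label * label)) : Prop :=
  [/\ alike l, uniq (map fst l), uniq (map snd l) &
    forall a b, a \in l -> b \in l ->
      (G [set point a.1; point b.1] <-> H [set point a.2; point b.2])].

Lemma swap_pairsK : involutive swap_pairs.
Proof.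
by move=> l; rewrite /swap_pairs -map_comp -[RHS]map_id; apply: eq_map => -[].
Qed.

Lemma map_fst_swap l : map fst (swap_pairs l) = map snd l.
Proof. by rewrite /swap_pairs -map_comp. Qed.

Lemma map_snd_swap l : map snd (swap_pairs l) = map fst l.
Proof. by rewrite /swap_pairs -map_comp. Qed.

(** This symmetry derives the back step from the forth step. *)
Lemma partial_iso_swap G H l : partial_iso G H l -> partial_iso H G (swap_pairs l).
Proof.
move=> [sim_l u1 u2 GH]; split; first exact: alike_swap.
- by rewrite map_fst_swap.
- by rewrite map_snd_swap.
- move=> _ _ /mapP[a al ->] /mapP[b bl ->] /=.
  by have [GHab HGab] := GH _ _ al bl; split.
Qed.

Lemma partial_iso_forth (S : set X) (G H : graph X) l c :
  G `<=` potential_edges S -> H `<=` potential_edges S -> generic H ->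
  partial_iso G H l -> c \notin map fst l ->
  exists c', partial_iso G H ((c, c') :: l).
Proof.
move=> GS HS genH [sim_l u1 u2 GH] cl.
(* The prescribed neighbours are the images of the neighbours of [c] in [G]. *)
pose A := [seq x.2 | x <- l & `[< G [set point c; point x.1] >]].
have [c' [sim_cl c'l Hc']] := genH l c A sim_l u2 cl.
have noloop (K : graph X) x : K `<=` potential_edges S -> ~ K [set x; x].
  by move=> KS /KS /potential_edgeP[].
have GHc x : x \in l ->
    (G [set point c; point x.1] <-> H [set point c'; point x.2]).
  move=> xl; have iso : `|point c' - point x.2| = `|point c - point x.1|.
    apply: (alike_isometry _ (c, c') x sim_cl); first exact: mem_head.
    by rewrite inE xl orbT.
  have AP : G [set point c; point x.1] <-> x.2 \in A.
    split=> [Gcx|/mapP[y]].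
      by apply: map_f; rewrite mem_filter xl andbT; apply/asboolP.
    rewrite mem_filter => /andP[/asboolP Gcy yl] xy.
    by rewrite (uniq_map_inj _ _ _ _ _ _ u2 xl yl xy).
  (* An edge in either graph forces distance less than 1, and the two distances agree, so genericity
     applies to the pair. *)
  split=> [Gcx|Hcx].
    have [_ cx] := potential_edgeP _ _ _ (GS _ Gcx).
    by apply/(Hc' _ xl cx)/AP.
  have [_] := potential_edgeP _ _ _ (HS _ Hcx); rewrite iso => cx.
  by apply/AP/(Hc' _ xl cx).
exists c'; split => //=; rewrite ?cl ?c'l // => a b.
rewrite !inE => /predU1P[->|al] /predU1P[->|bl] /=.
- by split=> [/(noloop _ _ GS)|/(noloop _ _ HS)].
- exact: GHc.
- by rewrite ![[set point a.1; _]]setUC ![[set point a.2; _]]setUC; exact: GHc.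
- exact: GH.
Qed.

Lemma generic_isomorphic (G H : graph X) :
  G `<=` potential_edges (range point) -> H `<=` potential_edges (range point) ->
  generic G -> generic H -> graph_isomorphic (range point) G H.
Proof.
move=> GS HS genG genH.
have iso0 : partial_iso G H [::] by split=> //; exact: alike_nil.
have forth l x : partial_iso G H l -> x \notin map fst l ->
    exists y, partial_iso G H ((x, y) :: l).
  exact: partial_iso_forth GS HS genH.
have back l y : partial_iso G H l -> y \notin map snd l ->
    exists x, partial_iso G H ((x, y) :: l).
  move=> /partial_iso_swap isol; rewrite -map_fst_swap => yl.
  have [x /partial_iso_swap] := partial_iso_forth _ _ _ _ _ HS GS genG isol yl.
  by rewrite /= -/(swap_pairs _) swap_pairsK; exists x.
have iso_uniq l : partial_iso G H l -> uniq (map fst l) /\ uniq (map snd l).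
  by case.
have [f bij_f Hf] := back_and_forth _ _ iso0 forth back iso_uniq.
(* An isomorphism is a map on all of [X], but only its values at the points matter. *)
have [F HF] : exists F : X -> X, forall q, F (point q) = point (f q).
  have /choice[F HF] : forall x, exists y, forall q, x = point q -> y = point (f q).
    move=> x; have [[q <-]|nx] := pselect (exists q, point q = x).
      by exists (point (f q)) => r /point_inj ->.
    by exists x => q xq; case: nx; exists q.
  by exists F => q; exact: HF.
have [g fg gf] := bij_f.
exists F; split; first split.
- by move=> _ [q _ <-]; rewrite HF; exists (f q).
- move=> x y; rewrite !inE => -[q _ <-] [r _ <-]; rewrite !HF.
  by move=> /point_inj /(can_inj fg) ->.
- by move=> _ [q _ <-]; exists (point (g q)); [exists (g q)|rewrite HF gf].
move=> _ _ [q _ <-] [r _ <-]; rewrite !HF.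
have [l [[_ _ _ GHl] ql rl]] := Hf q r.
exact: (GHl _ _ ql rl).
Qed.

Lemma Rado_points (p : R) : 0 < p < 1 -> Rado (range point) p.
Proof.
move=> p01 d Omega P G H rG rH _.
apply: filterS2 (generic_ae P p G p01 rG) (generic_ae P p H p01 rH) => w.
apply: generic_isomorphic.
  by case: rG.
by case: rH.
Qed.

End points.

Lemma exists_Rado_set (R : realType) (p : R) (X : completeNormedModType R) :
  0 < p < 1 -> has_1symmetric_basis X ->
  exists S : set X, [/\ countable S, dense S & Rado S p].
Proof.
move=> p01 [e e_basis]; exists (range (point e)); split.
- by apply: sub_countable (card_image_le _ _) _; exact: countableP.
- exact: dense_points.
- exact: Rado_points.
Qed.

(** * The unit vectors of the sequence spaces *)

Section ell.
Context {R : realType} {X : normedModType R}.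
Variables (q : R) (T : X -> nat -> R).
Hypothesis q1 : 1 < q.
Hypothesis T_linear : forall (c : R) (x y : X) i,
  T (c *: x + y) i = c * T x i + T y i.
Hypothesis T_norm : forall x : X,
  ((`|x|)%:E = 'N[counting]_(q%:E)[EFin \o T x])%E.
Hypothesis T_surj : forall a : nat -> R,
  ('N[counting]_(q%:E)[EFin \o a] < +oo)%E -> exists x, T x = a.

(** The q-th power of the norm of ell_q, infinite outside the space. *)
Definition power_sum (a : nat -> R) : \bar R :=
  (\sum_(0 <= k <oo) (`|a k| `^ q)%:E)%E.

Let q0 : 0 < q. Proof. exact: lt_trans q1. Qed.

Lemma Lnorm_power_sum a : ('N[counting]_(q%:E)[EFin \o a] = power_sum a `^ q^-1)%E.
Proof.
by rewrite Lnorm_counting.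
Qed.

Lemma power_sum_ge0 a : (0 <= power_sum a)%E.
Proof. by apply: nneseries_ge0 => k _ _; rewrite lee_fin powR_ge0. Qed.

Lemma power_sum_norm x : power_sum (T x) = (`|x| `^ q)%:E.
Proof.
rewrite -poweR_EFin T_norm Lnorm_power_sum -poweRrM mulVf ?gt_eqF //.
by rewrite poweRe1 // power_sum_ge0.
Qed.

Lemma power_sum_surj a : (power_sum a < +oo)%E -> exists x, T x = a.
Proof. by move=> a_fin; apply: T_surj; rewrite Lnorm_power_sum poweR_lty. Qed.

Lemma norm_eq_power_sum x y : power_sum (T x) = power_sum (T y) -> `|x| = `|y|.
Proof. by move=> xy; apply: EFin_inj; rewrite !T_norm !Lnorm_power_sum xy. Qed.

Lemma T0 i : T 0 i = 0.
Proof.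
have := T_linear 1 0 0 i; rewrite scaler0 addr0 mul1r => /eqP.
by rewrite -subr_eq subrr => /eqP.
Qed.

Lemma TZ c x i : T (c *: x) i = c * T x i.
Proof. by rewrite -[c *: x]addr0 T_linear T0 addr0. Qed.

Lemma TD x y i : T (x + y) i = T x i + T y i.
Proof. by rewrite -[x in LHS]scale1r T_linear mul1r. Qed.

Lemma TB x y i : T (x - y) i = T x i - T y i.
Proof. by rewrite TD -scaleN1r TZ mulN1r. Qed.

(** A single term of a series of nonnegative terms is at most its sum. *)
Lemma le_coordinate_norm x i : `|T x i| <= `|x|.
Proof.
rewrite leNgt; apply/negP => lt_xi.
have := gt0_ltr_powR q0 _ _ lt_xi; rewrite !nnegrE => /(_ (normr_ge0 _) (normr_ge0 _)).
apply/negP; rewrite -leNgt -lee_fin -power_sum_norm.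
have pos k : (0 <= (`|T x k| `^ q)%:E)%E by rewrite lee_fin powR_ge0.
apply: le_trans (nneseries_lim_ge (P := xpredT) i.+1 (fun k _ _ => pos k)).
by rewrite big_nat_recr //= leeDr // sume_ge0.
Qed.

Definition unit_sequence (j i : nat) : R := (i == j)%:R.

Lemma power_sum_unit j : (power_sum (unit_sequence j) < +oo)%E.
Proof.
rewrite /power_sum (nneseries_split 0 j.+1); last first.
  by move=> k _; rewrite lee_fin powR_ge0.
rewrite add0n eseries0 ?adde0 => [|k jk _]; last first.
  by rewrite /unit_sequence gtn_eqF // normr0 powR0 // gt_eqF.
by rewrite sumEFin ltry.
Qed.

Variable e : nat -> X.
Hypothesis Te : forall j, T (e j) = unit_sequence j.

Lemma T_lin_series a n k : T (lin_series e a n) k = if (k < n)%N then a k else 0.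
Proof.
elim: n => [|n IHn]; first by rewrite /lin_series /series /= big_nil T0.
rewrite /lin_series /series /= big_nat_recr //= TD TZ Te /unit_sequence.
rewrite -/(series _ n) -/(lin_series e a n) IHn ltnS.
by case: (ltngtP k n) => [_|_|->]; rewrite ?mulr0 ?addr0 // mulr1 add0r.
Qed.

(** The q-th power of the norm of the remainder is a tail of the convergent series
    [power_sum (T x)]. *)
Lemma cvg_lin_series_coordinates x : lin_series e (T x) @ \oo --> x.
Proof.
have Tx_fin : (power_sum (T x) < +oo)%E by rewrite power_sum_norm ltry.
have pos k : (0 <= (`|T x k| `^ q)%:E)%E by rewrite lee_fin powR_ge0.
have tail0 := nneseries_tail_cvg Tx_fin (fun k _ => pos k).
apply/cvgrPdist_lt => eps eps0.
have tailE n : (`|x - lin_series e (T x) n| `^ q)%:E =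
    (\sum_(n <= k <oo) (`|T x k| `^ q)%:E)%E.
  rewrite -power_sum_norm /power_sum [RHS]ereal_series_cond.
  rewrite [RHS]eseries_mkcond; apply: eq_eseriesr => k _.
  rewrite TB T_lin_series andbT; case: (ltnP k n) => _ /=.
    by rewrite subrr normr0 powR0 // gt_eqF.
  by rewrite subr0.
have epsq0 : (0 < (eps `^ q)%:E)%E by rewrite lte_fin powR_gt0.
have : \forall n \near \oo,
    (\sum_(n <= k <oo) (`|T x k| `^ q)%:E < (eps `^ q)%:E)%E.
  apply: (tail0 [set y | (y < (eps `^ q)%:E)%E]); apply: open_nbhs_nbhs.
  by split; first exact: open_ereal_lt_ereal.
apply: filterS => n; rewrite -tailE lte_fin => lt_eps.
rewrite ltNge; apply/negP => /(ge0_ler_powR (ltW q0)).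
rewrite !nnegrE => /(_ (ltW eps0) (normr_ge0 _)).
by rewrite leNgt lt_eps.
Qed.

Lemma unit_vectors_one_symmetric : one_symmetric_basis e.
Proof.
(* Coordinates are continuous by [le_coordinate_norm], which gives uniqueness of the expansion. *)
have coordinates x a : lin_series e a @ \oo --> x -> T x = a.
  move=> ax; apply/funext => k; apply/eqP; rewrite -subr_eq0 -normr_le0.
  apply/ler_addgt0Pr => eps eps0; rewrite add0r.
  have /cvgrPdist_lt /(_ _ eps0) [N _ HN] := ax.
  have kn : (k < maxn N k.+1)%N by rewrite leq_maxr.
  have := HN (maxn N k.+1) (leq_maxl _ _) => /ltW; apply: le_trans.
  by have := le_coordinate_norm (x - lin_series e a (maxn N k.+1)) k;
    rewrite TB T_lin_series kn.
split=> [x|pi a bij_pi /cvg_ex[x ax]].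
  exists (T x); split; first exact: cvg_lin_series_coordinates.
  by move=> a; apply: coordinates.
have Tx := coordinates _ _ ax.
(* Sums of nonnegative terms do not depend on the order. Hence the permuted sequence is again in the
   space, with the same norm. *)
have perm_sum : power_sum (a \o pi) = power_sum a.
  have pos (b : nat -> R) k : (0 <= (`|b k| `^ q)%:E)%E by rewrite lee_fin powR_ge0.
  rewrite /power_sum (nneseries_esumT (pos (a \o pi))) (nneseries_esumT (pos a)).
  rewrite [RHS](reindex_esum setT setT pi) //.
  by rewrite setTT_bijective.
have [|y Ty] := power_sum_surj (a \o pi).
  by rewrite perm_sum -Tx power_sum_norm ltry.
have ay : lin_series e (a \o pi) @ \oo --> y.
  by rewrite -Ty; exact: cvg_lin_series_coordinates.
split; first exact: cvgP ay.
rewrite (cvg_lim (@norm_hausdorff _ _) ax) (cvg_lim (@norm_hausdorff _ _) ay).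
by apply: norm_eq_power_sum; rewrite Tx Ty perm_sum.
Qed.

End ell.

Lemma ell_has_1symmetric_basis (R : realType) (q : R) (X : normedModType R) :
  1 < q -> is_ell q X -> has_1symmetric_basis X.
Proof.
move=> q1 [T [T_linear T_norm T_surj]].
have /choice[e Te] : forall j, exists x, T x = unit_sequence j.
  by move=> j; apply: power_sum_surj T_surj _ (power_sum_unit _ q1 _).
exists e; exact: unit_vectors_one_symmetric T_linear T_norm T_surj _ Te.
Qed.

Theorem theorem5 (R : realType) (p : R) (hp0 : 0 < p) (hp1 : p < 1)
    (X : completeNormedModType R) :
  (has_1symmetric_basis X ->
     exists S : set X, [/\ countable S, dense S & Rado S p]) /\
  (forall q : R, 1 < q -> is_ell q X -> has_1symmetric_basis X).
Proof.
split; first by apply: exists_Rado_set; rewrite hp0.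
by move=> q; exact: ell_has_1symmetric_basis.
Qed.
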